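(* For every split link $K$, the corner connection tile number is less than the traditional tile number: $t_c(K) < t(K)$.
   Context: Links are tame, in 3-space, up to ambient isotopy. A link is split if its components can be deformed so that some components lie on one side of a plane and the others on the other side. Each tile is a unit square. A connection point of a tile is an endpoint of a curve drawn on it. Traditional tiles (11 of them): connection points are midpoints of edges. $T_0$ is blank; four tiles ($T_1,\dots,T_4$) carry one arc joining the midpoints of two adjacent edges; two tiles ($T_5,T_6$) carry one segment joining the midpoints of two opposite edges; two tiles ($T_7,T_8$) carry two disjoint arcs each joining midpoints of adjacent edges; two tiles ($T_9,T_{10}$) carry the two segments joining midpoints of opposite edges, forming a crossing (two choices of over-strand). Corner connection tiles (11 of them): connection points are corners of the square. One tile is blank; four tiles carry one arc joining two adjacent corners; two tiles carry one diagonal; two tiles carry two disjoint arcs, each joining two adjacent corners, together using all four corners; two tiles carry both diagonals, forming a crossing (two choices of over-strand). A tile in an $n\times n$ array is suitably connected if each of its connection points touches a connection point of exactly one other tile of the array. An $n$-mosaic is an $n\times n$ array of tiles (all traditional, or all corner connection) in which every tile is suitably connected; it is a diagram of a knot or link. $t(K)$ (respectively $t_c(K)$) is the smallest number of non-blank tiles needed to construct $K$ on an $n$-mosaic of any size $n$ using traditional tiles (respectively corner connection tiles). *)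

(* Defs.v *)
From HB Require Import structures.
From mathcomp Require Import all_boot all_order all_algebra.
From mathcomp Require Import all_classical all_reals all_analysis.

Set Implicit Arguments.
Unset Strict Implicit.
Unset Printing Implicit Defensive.

Import Order.TTheory GRing.Theory Num.Theory.
Import numFieldNormedType.Exports.

Local Open Scope classical_set_scope.
Local Open Scope ring_scope.

(** * Tame links in 3-space *)

Definition space3 (R : realType) := (R * R * R)%type.

Definition segment (R : realType) (a b : space3 R) : set (space3 R) :=
  [set (1 - t) *: a + t *: b | t in `[0, 1]].

(* The segment without its endpoint [b]. *)
Definition half_open_segment (R : realType) (a b : space3 R) : set (space3 R) :=
  [set (1 - t) *: a + t *: b | t in `[0, 1[].

(* The half-open edges of a closed polygon are pairwise disjoint exactly when
   its piecewise-linear parametrization by the circle is injective. *)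
Definition simple_closed_polygon (R : realType) (C : set (space3 R)) : Prop :=
  exists m (v : 'I_m -> space3 R),
    [/\ (2 < m)%N,
        trivIset setT (fun i => half_open_segment (v i) (v (ordS i)))
      & C = \bigcup_i segment (v i) (v (ordS i))].

Definition polygonal_link (R : realType) (L : set (space3 R)) : Prop :=
  exists m (C : 'I_m -> set (space3 R)),
    [/\ forall i, simple_closed_polygon (C i),
        trivIset setT C
      & L = \bigcup_i C i].

Definition homeomorphism (R : realType) (f : space3 R -> space3 R) : Prop :=
  continuous f /\
  exists g : space3 R -> space3 R, [/\ continuous g, cancel f g & cancel g f].

Definition ambient_isotopic (R : realType) (K L : set (space3 R)) : Prop :=
  exists H : R -> space3 R -> space3 R,
    [/\ {within `[0, 1] `*` [set: space3 R],
          continuous (fun p : R * space3 R => H p.1 p.2)},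
        forall t, 0 <= t <= 1 -> homeomorphism (H t),
        forall x, H 0 x = x
      & H 1 @` K = L].

(* Tameness is equivalence to a polygonal link. *)
Definition tame_link (R : realType) (K : set (space3 R)) : Prop :=
  exists2 L, polygonal_link L & ambient_isotopic L K.

Definition dot (R : realType) (a x : space3 R) : R :=
  a.1.1 * x.1.1 + a.1.2 * x.1.2 + a.2 * x.2.

(* The plane is [dot a x = b]; every component of the deformed link lies on
   one side of it, and both sides occur. *)
Definition split_link (R : realType) (K : set (space3 R)) : Prop :=
  exists (L : set (space3 R)) (a : space3 R) (b : R),
    [/\ ambient_isotopic K L,
        a != 0,
        forall x, L x ->
          connected_component L x `<=` [set y | dot a y < b] \/
          connected_component L x `<=` [set y | b < dot a y],
        exists2 x, L x & connected_component L x `<=` [set y | dot a y < b]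
      & exists2 x, L x & connected_component L x `<=` [set y | b < dot a y]].

(** * Tiles and mosaics *)

(* A tile has four possible connection points, numbered clockwise by ['I_4]
   (arithmetic is modulo 4): [k] and [k + 1] are consecutive, [k] and [k + 2]
   are opposite.  [Arc k] joins [k] to [k + 1]; [Line k] and [Over k] join
   [k] to [k + 2], the latter being the upper strand of a crossing. *)
Inductive curve := Arc of 'I_4 | Line of 'I_4 | Over of 'I_4.

(* 1 + 4 + 2 + 2 + 2 tiles.  The two sets of eleven tiles have the same
   combinatorics and differ only by the location of the connection points. *)
Inductive tile :=
  | Blank
  | OneArc of 'I_4
  | OneLine of bool
  | TwoArcs of bool
  | Crossing of bool.

Definition is_blank (T : tile) : bool := if T is Blank then true else false.

Definition curves (T : tile) : seq curve :=
  match T with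
  | Blank => [::]
  | OneArc k => [:: Arc k]
  | OneLine b => [:: Line (if b then 1 else 0)]
  | TwoArcs b => let k := if b then 1 else 0 in [:: Arc k; Arc (k + 2)]
  | Crossing b => let k := if b then 1 else 0 in [:: Over k; Line (k + 1)]
  end.

Definition source (c : curve) : 'I_4 :=
  match c with Arc k | Line k | Over k => k end.

Definition target (c : curve) : 'I_4 :=
  match c with Arc k => k + 1 | Line k | Over k => k + 2 end.

Definition connection_points (T : tile) : seq 'I_4 :=
  flatten [seq [:: source c; target c] | c <- curves T].

Inductive style := Traditional | Corner.

(* Plane points are given by integer coordinates in units of half the side of
   a tile; [offset] is relative to the centre of the tile. *)
Definition offset (s : style) (k : 'I_4) : int * int :=
  match s with
  | Traditional => nth (0, 0) [:: (0, 1); (1, 0); (0, -1); (-1, 0)] k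
  | Corner => nth (0, 0) [:: (1, 1); (1, -1); (-1, -1); (-1, 1)] k
  end.

(* Rows are numbered downwards, columns to the right. *)
Definition centre n (q : 'I_n * 'I_n) : int * int :=
  ((q.2 : nat).*2.+1%:Z, - (q.1 : nat).*2.+1%:Z).

Definition site (s : style) n (q : 'I_n * 'I_n) (k : 'I_4) : int * int :=
  ((centre q).1 + (offset s k).1, (centre q).2 + (offset s k).2).

Definition touches (s : style) n (M : 'M[tile]_n) (x : int * int)
    (q : 'I_n * 'I_n) : bool :=
  has (fun k => site s q k == x) (connection_points (M q.1 q.2)).

Definition suitably_connected (s : style) n (M : 'M[tile]_n)
    (q : 'I_n * 'I_n) : Prop :=
  forall k, k \in connection_points (M q.1 q.2) ->
    #|[pred r : 'I_n * 'I_n | (r != q) && touches s M (site s q k) r]| = 1%N.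

Definition mosaic (s : style) n (M : 'M[tile]_n) : Prop :=
  forall q, suitably_connected s M q.

Definition nonblank_tiles n (M : 'M[tile]_n) : nat :=
  #|[pred q : 'I_n * 'I_n | ~~ is_blank (M q.1 q.2)]|.

(** * The link of a mosaic *)

(* Tiles are unit squares of the plane [z = 0]. *)
Definition plane_point (R : realType) (x : int * int) : space3 R :=
  (x.1%:~R / 2, x.2%:~R / 2, 0).

(* Every curve is drawn as a two-segment path through its way point: halfway
   between the centre of the tile and the middle of the chord for an arc (so
   that an arc between two corners leaves the edge and runs inside the tile),
   the centre for a lower or single strand, and one unit above the centre for
   the upper strand of a crossing. *)
Definition way_point (R : realType) (s : style) n (q : 'I_n * 'I_n)
    (c : curve) : space3 R :=
  let o := plane_point R (centre q) in
  match c with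
  | Arc k => 2^-1 *: o +
      4^-1 *: (plane_point R (site s q k) + plane_point R (site s q (k + 1)))
  | Line _ => o
  | Over _ => o + (0, 0, 1)
  end.

Definition draw (R : realType) (s : style) n (q : 'I_n * 'I_n) (c : curve) :
    set (space3 R) :=
  segment (plane_point R (site s q (source c))) (way_point R s q c) `|`
  segment (way_point R s q c) (plane_point R (site s q (target c))).

Definition mosaic_link (R : realType) (s : style) n (M : 'M[tile]_n) :
    set (space3 R) :=
  \bigcup_(q : 'I_n * 'I_n)
    \big[setU/set0]_(c <- curves (M q.1 q.2)) draw s q c.

Definition constructs (R : realType) (s : style) n (M : 'M[tile]_n)
    (K : set (space3 R)) : Prop :=
  mosaic s M /\ ambient_isotopic (mosaic_link s M) K.

(* [t] is the smallest number of non-blank tiles of a mosaic of [K]. *)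
Definition tile_number (R : realType) (s : style) (K : set (space3 R))
    (t : nat) : Prop :=
  (exists n (M : 'M[tile]_n), constructs s M K /\ nonblank_tiles M = t) /\
  (forall n (M : 'M[tile]_n), constructs s M K -> (t <= nonblank_tiles M)%N).

(* Main.v *)
Require Import Defs.
From mathcomp Require Import all_boot all_order all_algebra.
From mathcomp Require Import all_classical all_reals all_analysis.
From mathcomp Require Import zify ring lra.

Set Implicit Arguments.
Unset Strict Implicit.
Unset Printing Implicit Defensive.

Import Order.TTheory GRing.Theory Num.Theory.
Import numFieldNormedType.Exports.

Local Open Scope classical_set_scope.
Local Open Scope ring_scope.

(** The midpoints of the edges of a square grid form a square grid themselves,
turned by an eighth of a turn.  Its cells are the diamonds inscribed in the
tiles and the diamonds around the vertices of the original grid, in a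
checkerboard pattern.  A traditional mosaic, drawn inside the diamonds of the
first kind, is therefore already a corner connection mosaic of the turned grid
with the same tiles: a rotation and a dilation by the square root of 2
([eighth_turn_link]) turn the one picture into the other.

The diamonds around the vertices are still blank, and using them saves a tile.
The leftmost tile of the topmost occupied row of a traditional mosaic has no
connection point above it or to its left, so it is an arc going right and
down; following it to the right, straight segments lead to an arc going back
down ([cap_exists]).  Nothing lies above this cap of [k + 2] tiles, and nothing
reaches it from below between its ends, so it can be pushed down onto the lower
edge of its row ([push_link]).  It then crosses, from corner to corner, exactly
the [k + 1] diamonds around the vertices of that edge: the cap is replaced by
[k + 1] diagonal tiles ([lowered]), the result is suitably connected
([lowered_mosaic]) and has fewer nonblank tiles ([nonblank_lowered]).

Throughout, a mosaic is treated as a function from the integer points of the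
plane to tiles, which gives the tile with a given centre.  Suitable
connectedness then says that every point is touched by no tile or by exactly
two ([mosaic_degree]).  In this form the pushed diagram, which mixes both kinds
of diamonds, can be described before it is rotated into a matrix of tiles. *)

(** * Ambient isotopy is symmetric and transitive *)

Lemma within_continuous_comp_in (X Y Z : topologicalType) (A : set X)
    (B : set Y) (h : X -> Y) (F : Y -> Z) :
  {within B, continuous F} -> {within A, continuous h} ->
  (forall x, A x -> B (h x)) -> {within A, continuous (F \o h)}.
Proof.
move=> /subspace_continuousP cF /subspace_continuousP ch AB.
apply/subspace_continuousP => x Ax.
move=> U FU; have := ch x Ax _ (cF _ (AB _ Ax) _ FU).
rewrite !nbhs_simpl /= /within /= => HU.
by apply: (filterS (F := nbhs x) _ HU) => y /= + Ay; apply => //; exact: AB.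
Qed.

Lemma homeomorphism_comp (R : realType) (f g : space3 R -> space3 R) :
  homeomorphism f -> homeomorphism g -> homeomorphism (g \o f).
Proof.
move=> [cf [f' [cf' fK f'K]]] [cg [g' [cg' gK g'K]]]; split.
  by move=> x; apply: continuous_comp; [exact: cf|exact: cg].
exists (f' \o g'); split.
- by move=> x; apply: continuous_comp; [exact: cg'|exact: cf'].
- exact: can_comp.
- exact: can_comp.
Qed.

Lemma continuous_pair (X Y Z : topologicalType) (f : X -> Y) (g : X -> Z) :
  continuous f -> continuous g -> continuous (fun x => (f x, g x)).
Proof. by move=> cf cg x; apply: cvg_pair; [exact: cf|exact: cg]. Qed.

(** Running both isotopies at once, as [G t \o H t], needs no reparametrization
and no gluing at the middle of the time interval. *)
Lemma ambient_isotopic_trans (R : realType) (K L P : set (space3 R)) :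
  ambient_isotopic K L -> ambient_isotopic L P -> ambient_isotopic K P.
Proof.
move=> [H [cH hH H0 HKL]] [G [cG hG G0 GLP]].
exists (fun t => G t \o H t); split.
- have ch : {within `[0, 1] `*` [set: space3 R],
      continuous (fun p : R * space3 R => (p.1, H p.1 p.2))}.
    apply/subspace_continuousP => x Ax.
    apply: (@cvg_pair _ _ _ _ (nbhs x.1) (nbhs (H x.1 x.2))) => /=.
      apply: (cvg_within_filter (F := nbhs x)); exact: cvg_fst.
    by move/subspace_continuousP: cH => /(_ x Ax).
  by apply: (within_continuous_comp_in cG ch).
- by move=> t t01; apply: homeomorphism_comp; [exact: hH|exact: hG].
- by move=> x /=; rewrite H0 G0.
- by rewrite -GLP -HKL image_comp.
Qed.

(** The inverse isotopy is [H (1 - t)] after the inverse of [H 1]; only this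
one inverse has to be continuous, not the inverses of all [H t] jointly. *)
Lemma ambient_isotopic_sym (R : realType) (K L : set (space3 R)) :
  ambient_isotopic K L -> ambient_isotopic L K.
Proof.
move=> [H [cH hH H0 HKL]].
have [|cH1 [g [cg Hg gH]]] := hH 1; first by rewrite ler01 lexx.
exists (fun t => H (1 - t) \o g); split.
- have ch : {within `[0, 1] `*` [set: space3 R],
      continuous (fun p : R * space3 R => (1 - p.1, g p.2))}.
    apply: continuous_subspaceT; apply: continuous_pair => x /=.
      by apply: cvgB; [exact: cvg_cst|exact: cvg_fst].
    by apply: (continuous_comp (f := snd)); [exact: cvg_snd|exact: cg].
  apply: (within_continuous_comp_in cH ch) => -[t x] [/= t01 _].
  by split => //; move: t01; rewrite /= !in_itv /=; lra.
- move=> t t01; apply: homeomorphism_comp; last by apply: hH; lra.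
  by split=> //; exists (H 1).
- by move=> x /=; rewrite subr0 gH.
- rewrite -HKL image_comp (_ : _ \o _ = id) ?image_id //.
  by apply/funext => x /=; rewrite Hg subrr H0.
Qed.

(** * A shear and a rotation *)

Lemma ambient_isotopic_image (R : realType) (H G : R -> space3 R -> space3 R)
    (K : set (space3 R)) :
  continuous (fun p : R * space3 R => H p.1 p.2) ->
  (forall t, 0 <= t <= 1 -> continuous (G t)) ->
  (forall t, 0 <= t <= 1 -> cancel (H t) (G t)) ->
  (forall t, 0 <= t <= 1 -> cancel (G t) (H t)) ->
  (forall x, H 0 x = x) ->
  ambient_isotopic K (H 1 @` K).
Proof.
move=> cH cG HK GK H0; exists H; split=> // [|t t01].
  exact: continuous_subspaceT.
split; last by exists (G t); split; [exact: cG|exact: HK|exact: GK].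
move=> x; apply: (@continuous_comp _ _ _ (fun x => (t, x))
  (fun p : R * space3 R => H p.1 p.2)); last exact: cH.
by apply: continuous_pair => y; [exact: cvg_cst|exact: cvg_id].
Qed.

Section continuity.
Variables (R : realType) (T : topologicalType).
Implicit Types f g : T -> R.

Lemma ctsD f g : continuous f -> continuous g ->
  continuous (fun x => f x + g x).
Proof. by move=> cf cg x; apply: cvgD; [exact: cf|exact: cg]. Qed.

Lemma ctsN f : continuous f -> continuous (fun x => - f x).
Proof. by move=> cf x; apply: cvgN; exact: cf. Qed.

Lemma ctsM f g : continuous f -> continuous g ->
  continuous (fun x => f x * g x).
Proof. by move=> cf cg x; apply: cvgM; [exact: cf|exact: cg]. Qed.

Lemma cts_min f g : continuous f -> continuous g ->
  continuous (fun x => Num.min (f x) (g x)).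
Proof. by move=> cf cg x; apply: continuous_min; [exact: cf|exact: cg]. Qed.

Lemma cts_max f g : continuous f -> continuous g ->
  continuous (fun x => Num.max (f x) (g x)).
Proof. by move=> cf cg x; apply: continuous_max; [exact: cf|exact: cg]. Qed.

Lemma cts_cst (c : R) : continuous (fun _ : T => c).
Proof. by move=> x; exact: cvg_cst. Qed.

End continuity.

Section projections.
Variables (R : realType) (X : topologicalType).

Lemma cts_fst (Y Z : topologicalType) (f : X -> Y * Z) :
  continuous f -> continuous (fun x => (f x).1).
Proof.
by move=> cf x; apply: (continuous_comp (g := fst)); [exact: cf|exact: cvg_fst].
Qed.

Lemma cts_snd (Y Z : topologicalType) (f : X -> Y * Z) :
  continuous f -> continuous (fun x => (f x).2).
Proof.
by move=> cf x; apply: (continuous_comp (g := snd)); [exact: cf|exact: cvg_snd].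
Qed.

Lemma cts_comp (f : R -> R) (g : X -> R) :
  continuous f -> continuous g -> continuous (fun x => f (g x)).
Proof. by move=> cf cg x; apply: continuous_comp; [exact: cg|exact: cf]. Qed.

End projections.

Ltac cts := first [ assumption | lazymatch goal with
  | |- continuous (fun p => (_, _)) => apply: continuous_pair; cts
  | |- continuous (fun p => (_).1) => apply: cts_fst; cts
  | |- continuous (fun p => (_).2) => apply: cts_snd; cts
  | |- continuous (fun p => _ + _) => apply: ctsD; cts
  | |- continuous (fun p => - _) => apply: ctsN; cts
  | |- continuous (fun p => _ * _) => apply: ctsM; cts
  | |- continuous (fun p => Num.min _ _) => apply: cts_min; cts
  | |- continuous (fun p => Num.max _ _) => apply: cts_max; cts
  | |- continuous fst => by move=> ?; exact: cvg_fst
  | |- continuous snd => by move=> ?; exact: cvg_snd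
  | |- continuous id => by move=> ?; exact: cvg_id
  | |- continuous (fun p => p) => by move=> ?; exact: cvg_id
  | |- _ => first [ exact: cts_cst | apply: ctsM; cts | apply: ctsD; cts
                  | apply: ctsN; cts ]
  end ].

Section clamp.
Variables (R : realType) (c h : R).
Hypotheses (c0 : 0 < c) (h0 : 0 <= h).

Definition clamp (w : R) : R := Num.max 0 (Num.min (w / c) h).

Lemma clamp_le w : w <= 0 -> clamp w = 0.
Proof.
move=> w0; apply/max_idPl; rewrite ge_min; apply/orP; left.
by rewrite mulr_le0_ge0 // invr_ge0 ltW.
Qed.

Lemma clamp_mid w : 0 <= w <= h * c -> clamp w = w / c.
Proof.
move=> /andP[w0 wh]; rewrite /clamp min_l ?ler_pdivrMr // max_r //.
by rewrite divr_ge0 // ltW.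
Qed.

Lemma clamp_ge w : h * c <= w -> clamp w = h.
Proof. by move=> wh; rewrite /clamp min_r ?ler_pdivlMr // max_r. Qed.

End clamp.

Section shear.
Variables (R : realType) (f : R -> R) (y0 : R).
Hypothesis f0 : forall x, 0 <= f x.

(** On each vertical line, the segment of half-length [f x] around height [y0]
is squeezed so that its top [y0 + f x] descends to [y0 + (1 - t) * f x], its
bottom stays fixed, and everything above it follows by a translation. *)
Definition shear (t : R) (p : space3 R) : space3 R :=
  (p.1.1, p.1.2 - t * clamp 2 (f p.1.1) (p.1.2 - y0 + f p.1.1), p.2).

(** The squeezed segment has shrunk by the factor [(2 - t) / 2]. *)
Definition unshear (t : R) (p : space3 R) : space3 R :=
  (p.1.1, p.1.2 + t * clamp (2 - t) (f p.1.1) (p.1.2 - y0 + f p.1.1), p.2).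

Lemma shearK t : 0 <= t <= 1 -> cancel (shear t) (unshear t).
Proof.
move=> t01 [[x y] z]; rewrite /shear /unshear /=; congr (_, _, _).
have h0 := f0 x; move: (f x) h0 => h h0.
have t2 : 0 < 2 - t by lra.
have [w0|w0] := lerP (y - y0 + h) 0.
  by rewrite !clamp_le //; lra.
have [wh|wh] := lerP (y - y0 + h) (h * 2).
  rewrite [clamp 2 _ _]clamp_mid ?(ltW w0) //.
  rewrite clamp_mid //; first by field; lra.
  by apply/andP; split; nra.
by rewrite [clamp 2 _ _]clamp_ge ?(ltW wh) // clamp_ge //; lra.
Qed.

Lemma unshearK t : 0 <= t <= 1 -> cancel (unshear t) (shear t).
Proof.
move=> t01 [[x y] z]; rewrite /shear /unshear /=; congr (_, _, _).
have h0 := f0 x; move: (f x) h0 => h h0.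
have t2 : 0 < 2 - t by lra.
have [w0|w0] := lerP (y - y0 + h) 0.
  by rewrite !clamp_le //; lra.
have [wh|wh] := lerP (y - y0 + h) (h * (2 - t)).
  rewrite [clamp (2 - t) _ _]clamp_mid ?(ltW w0) //.
  have w1 : 0 <= (y - y0 + h) / (2 - t) by rewrite divr_ge0 // ltW.
  have w2 : (y - y0 + h) / (2 - t) <= h by rewrite ler_pdivrMr.
  have w3 : y - y0 + h = (y - y0 + h) / (2 - t) * (2 - t).
    by rewrite divfK // gt_eqF.
  rewrite clamp_mid //; first by field; lra.
  by move: w1 w2 w3; move: (_ / (2 - t)) => w w1 w2 w3; apply/andP; split; nra.
by rewrite [clamp (2 - t) _ _]clamp_ge ?(ltW wh) // clamp_ge //; lra.
Qed.

Lemma shear_isotopic (K : set (space3 R)) :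
  continuous f -> ambient_isotopic K (shear 1 @` K).
Proof.
move=> cf.
apply: (@ambient_isotopic_image _ shear unshear) => [|t t01|t t01|t t01|].
- have c1 : continuous (fun p : R * space3 R => f p.2.1.1).
    by apply: cts_comp => //; cts.
  by rewrite /shear /clamp; cts.
- have c1 : continuous (fun p : space3 R => f p.1.1).
    by apply: cts_comp => //; cts.
  by rewrite /unshear /clamp; cts.
- exact: shearK.
- exact: unshearK.
- by move=> [[x y] z]; rewrite /shear /= mul0r subr0.
Qed.

End shear.

Section turn.
Variables (R : realType) (a b : R).

(** The path [[1 t; -t 1]] of linear maps, of determinant [1 + t ^+ 2], from the
identity to a clockwise eighth of a turn with ratio [sqrt 2]; [a] and [b] only
translate. *)
Definition turn (t : R) (p : space3 R) : space3 R :=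
  (p.1.1 + t * (p.1.2 + a), p.1.2 + t * (b - p.1.1), p.2).

Definition unturn (t : R) (p : space3 R) : space3 R :=
  ((p.1.1 - t * a - t * (p.1.2 - t * b)) / (1 + t ^+ 2),
   (p.1.2 - t * b + t * (p.1.1 - t * a)) / (1 + t ^+ 2), p.2).

Lemma turn_isotopic (K : set (space3 R)) : ambient_isotopic K (turn 1 @` K).
Proof.
have t0 (t : R) : 1 + t ^+ 2 != 0 by have := sqr_ge0 t; lra.
apply: (@ambient_isotopic_image _ turn unturn) => [|t t01|t t01|t t01|].
- by rewrite /turn; cts.
- by rewrite /unturn; cts.
- by move=> [[x y] z]; rewrite /turn /unturn /=; congr (_, _, _); field.
- by move=> [[x y] z]; rewrite /turn /unturn /=; congr (_, _, _); field.
- by move=> [[x y] z]; rewrite /turn /= !mul0r !addr0.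
Qed.

End turn.

(** * Mosaics as functions of the centres of the tiles *)

Definition conn (T : tile) (k : 'I_4) : bool := k \in connection_points T.

Definition tile_at n (M : 'M[tile]_n) (z : int * int) : tile :=
  if [pick q | centre q == z] is Some q then M q.1 q.2 else Blank.

(** The tile that has its [k]-th connection point at [p], if any tile does, is
centred at [p - offset s k]. *)
Definition linked (s : style) (T : int * int -> tile) (p : int * int)
    (k : 'I_4) : bool := conn (T (p - offset s k)) k.

Definition degree (s : style) (T : int * int -> tile) (p : int * int) : nat :=
  linked s T p 0 + linked s T p 1 + linked s T p 2 + linked s T p 3.

Lemma ordinal4P (P : 'I_4 -> Prop) : P 0 -> P 1 -> P 2 -> P 3 -> forall k, P k.
Proof.
move=> P0 P1 P2 P3; case=> [[|[|[|[|//]]]]] lt4.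
- by rewrite (_ : Ordinal lt4 = 0) //; apply/val_inj.
- by rewrite (_ : Ordinal lt4 = 1) //; apply/val_inj.
- by rewrite (_ : Ordinal lt4 = 2) //; apply/val_inj.
- by rewrite (_ : Ordinal lt4 = 3) //; apply/val_inj.
Qed.

Lemma card_ordinal4 (P : pred 'I_4) : #|P| = (P 0%R + P 1%R + P 2%R + P 3%R)%N.
Proof.
rewrite -sum1_card big_mkcond /= !big_ord_recl big_ord0 /= addn0 !addnA.
have -> : lift ord0 ord0 = 1 :> 'I_4 by apply/val_inj.
have -> : lift ord0 (lift ord0 ord0) = 2 :> 'I_4 by apply/val_inj.
have -> : lift ord0 (lift ord0 (lift ord0 ord0)) = 3 :> 'I_4 by apply/val_inj.
have -> : ord0 = 0 :> 'I_4 by apply/val_inj.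
by rewrite /in_mem /=; do 4 case: (P _).
Qed.

Lemma offset_inj s : injective (offset s).
Proof.
by case: s => k j; elim/ordinal4P: k; elim/ordinal4P: j.
Qed.

Lemma centre_inj n : injective (@centre n).
Proof.
move=> [i j] [i' j']; rewrite /centre /= => -[] ej ei.
by congr (_, _); apply/val_inj => /=; lia.
Qed.

Lemma tile_at_centre n (M : 'M[tile]_n) q : tile_at M (centre q) = M q.1 q.2.
Proof.
rewrite /tile_at; case: pickP => [r /eqP/centre_inj -> //|/(_ q)].
by rewrite eqxx.
Qed.

Lemma tile_at_blank n (M : 'M[tile]_n) z :
  (forall q : 'I_n * 'I_n, centre q != z) -> tile_at M z = Blank.
Proof.
move=> H; rewrite /tile_at; case: pickP => // q /eqP E.
by move: (H q); rewrite E eqxx.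
Qed.

Lemma tile_at_nonblank n (M : 'M[tile]_n) z :
  ~~ is_blank (tile_at M z) -> exists q : 'I_n * 'I_n, z = centre q.
Proof.
by rewrite /tile_at; case: pickP => // q /eqP <-; exists q.
Qed.

Lemma conn_nonblank T k : conn T k -> ~~ is_blank T.
Proof. by case: T. Qed.

Lemma siteE s n (q : 'I_n * 'I_n) k : site s q k = centre q + offset s k.
Proof. by []. Qed.

Lemma touchesP s n (M : 'M[tile]_n) p r :
  reflect (exists2 j, linked s (tile_at M) p j & centre r = p - offset s j)
    (touches s M p r).
Proof.
apply: (iffP hasP) => [[j cj /eqP <-]|[j lj cr]].
  by exists j; rewrite siteE ?addrK // /linked addrK tile_at_centre.
exists j; last by rewrite siteE cr subrK.
by move: lj; rewrite /linked -cr tile_at_centre.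
Qed.

(** A tile touching [p] is determined by which of its connection points lies
at [p], because the offsets are distinct. *)
Lemma card_touches s n (M : 'M[tile]_n) (q : 'I_n * 'I_n) p k :
  centre q = p - offset s k ->
  #|[pred r : 'I_n * 'I_n | (r != q) && touches s M p r]| =
  #|[pred j | (j != k) && linked s (tile_at M) p j]|.
Proof.
move=> cq.
pose g j := odflt q [pick r | centre r == p - offset s j].
have gP j : linked s (tile_at M) p j -> centre (g j) = p - offset s j.
  move=> /conn_nonblank/tile_at_nonblank[r er]; rewrite /g.
  by case: pickP => [r' /eqP //|/(_ r)]; rewrite er eqxx.
rewrite -(@card_in_image _ _ g [pred j | (j != k) && linked s (tile_at M) p j]).
  apply: eq_card => r; rewrite inE; apply/idP/fintype.imageP.
    case/andP=> rq /touchesP[j lj cr]; exists j; last first.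
      by apply: centre_inj; rewrite gP.
    rewrite inE lj andbT; apply: contra rq => /eqP jk.
    by apply/eqP/centre_inj; rewrite cq cr jk.
  case=> j; rewrite inE => /andP[jk lj] ->; apply/andP; split.
    apply: contra jk => /eqP gq; apply/eqP; apply: (@offset_inj s).
    by apply: oppr_inj; apply: (addrI p); rewrite -gP // -cq gq.
  by apply/touchesP; exists j => //; exact: gP.
move=> j j'; rewrite !inE => /andP[_ lj] /andP[_ lj'] E.
apply: (@offset_inj s); apply: oppr_inj; apply: (addrI p).
by rewrite -!gP // E.
Qed.

Lemma linked_degree s T p k : linked s T p k ->
  #|[pred j | (j != k) && linked s T p j]|.+1 = degree s T p.
Proof.
rewrite card_ordinal4 /degree /=; elim/ordinal4P: k => -> /=; lia.
Qed.

(** Together with the connection point under consideration, suitable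
connectedness counts two tiles at every point that some tile touches. *)
Lemma mosaic_degree s n (M : 'M[tile]_n) :
  mosaic s M <-> forall p, degree s (tile_at M) p \in [:: 0; 2]%N.
Proof.
split=> [mM p|mM q k ck].
  have [k lk|nl] := pickP (linked s (tile_at M) p); last first.
    by rewrite /degree !nl.
  have [q cq] := tile_at_nonblank (conn_nonblank lk).
  rewrite -(linked_degree lk) -(card_touches M (esym cq)).
  have := mM q k; rewrite siteE -cq subrK => -> //.
  by move: lk; rewrite /linked cq tile_at_centre.
rewrite siteE (@card_touches _ _ _ _ _ k) ?addrK //.
have lk : linked s (tile_at M) (centre q + offset s k) k.
  by rewrite /linked addrK tile_at_centre.
have := mM (centre q + offset s k).
by rewrite -(linked_degree lk) !inE => /orP[//|/eqP[]].
Qed.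

(** * The cap of a traditional mosaic *)

Definition odd_supported (T : int * int -> tile) : Prop :=
  forall x y, (2 %| x)%Z || (2 %| y)%Z -> T (x, y) = Blank.

Lemma tile_at_odd_supported n (M : 'M[tile]_n) : odd_supported (tile_at M).
Proof.
move=> x y xy; apply: tile_at_blank => -[i j].
by apply/eqP => -[] /= *; lia.
Qed.

Definition closed_diagram s T := forall p, degree s T p \in [:: 0; 2]%N.

Lemma conn_blank k : conn Blank k = false.
Proof. by []. Qed.

Lemma linked_traditional T x y :
  (linked Traditional T (x, y) 0 = conn (T (x, y - 1)) 0) *
  (linked Traditional T (x, y) 1 = conn (T (x - 1, y)) 1) *
  (linked Traditional T (x, y) 2 = conn (T (x, y + 1)) 2) *
  (linked Traditional T (x, y) 3 = conn (T (x + 1, y)) 3).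
Proof.
rewrite /linked /offset /=; split; [split; [split|]|]; congr (conn (T _) _).
- by congr (_, _) => /=; lia.
- by congr (_, _) => /=; lia.
- by congr (_, _) => /=; lia.
- by congr (_, _) => /=; lia.
Qed.

Section traditional.
Variable T : int * int -> tile.
Hypotheses (oT : odd_supported T) (dT : closed_diagram Traditional T).

Lemma conn_vertical x y : conn (T (x, y - 1)) 0 = conn (T (x, y + 1)) 2.
Proof.
have [xe|xo] := boolP (2 %| x)%Z; first by rewrite !oT ?xe.
have [ye|yo] := boolP (2 %| y)%Z; last first.
  by rewrite !oT //; apply/orP; right; lia.
have := dT (x, y); rewrite /degree !linked_traditional.
rewrite (oT (x := x - 1)) ?ye ?orbT // (oT (x := x + 1)) ?ye ?orbT //.
by rewrite !conn_blank !inE; do 2 case: conn.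
Qed.

Lemma conn_horizontal x y : conn (T (x - 1, y)) 1 = conn (T (x + 1, y)) 3.
Proof.
have [ye|yo] := boolP (2 %| y)%Z; first by rewrite !oT ?ye ?orbT.
have [xe|xo] := boolP (2 %| x)%Z; last first.
  by rewrite !oT //; apply/orP; left; lia.
have := dT (x, y); rewrite /degree !linked_traditional.
rewrite (oT (y := y - 1)) ?xe // (oT (y := y + 1)) ?xe //.
by rewrite !conn_blank !inE; do 2 case: conn.
Qed.

End traditional.

(** The arc at [l] goes right and down, the arc at [r] left and down, and the
tiles between them are horizontal segments. *)
Record cap (T : int * int -> tile) (l r h : int) : Prop := Cap {
  cap_lt : l < r;
  cap_left : T (l, h) = OneArc 1;
  cap_right : T (r, h) = OneArc 2;
  cap_middle : forall x, l < x < r -> ~~ (2 %| x)%Z -> T (x, h) = OneLine true;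
  cap_above : forall x y, h < y -> T (x, y) = Blank }.

Lemma left_end_of_cap T : ~~ is_blank T -> ~~ conn T 0 -> ~~ conn T 3 ->
  T = OneArc 1.
Proof.
case: T => // [k|[]|[]|[]] //.
by elim/ordinal4P: k.
Qed.

Lemma right_end_of_cap T : ~~ conn T 0 -> conn T 3 -> T <> OneLine true ->
  T = OneArc 2.
Proof.
case: T => // [k|[]|[]|[]] //.
by elim/ordinal4P: k.
Qed.

Definition is_hline T := if T is OneLine true then true else false.

Lemma is_hlineP T : reflect (T = OneLine true) (is_hline T).
Proof. by case: T => [|?|[]|?|?]; constructor. Qed.

(** The left end is the first nonblank tile in reading order.  Tiles of its row
have no upper connection point, so the curve leaving it to the right stays
horizontal until it turns down, and it has to turn before the mosaic ends. *)
Lemma cap_exists n (M : 'M[tile]_n) (q0 : 'I_n * 'I_n) :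
  mosaic Traditional M -> ~~ is_blank (M q0.1 q0.2) ->
  exists l r h, cap (tile_at M) l r h.
Proof.
move=> /mosaic_degree dM nb0; pose T := tile_at M.
have oT : odd_supported T by exact: tile_at_odd_supported.
have [q nbq minq] := @arg_minnP _ q0 (fun q => ~~ is_blank (M q.1 q.2))
  (fun q => (q.1 * n + q.2)%N) nb0.
pose l := (centre q).1; pose h := (centre q).2.
have blank x y : (h < y) || (y == h) && (x < l) -> T (x, y) = Blank.
  move=> xy; have [|nb] := boolP (is_blank (T (x, y))).
    by case: (T (x, y)).
  have [q' eq'] := tile_at_nonblank nb.
  have := minq q'; rewrite -tile_at_centre -eq' => /(_ nb).
  move: eq' xy; rewrite /h /l /centre /= => -[-> ->].
  have := ltn_ord q.2; have := ltn_ord q'.2; have := ltn_ord q.1.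
  case: q {nbq minq l h} => i j; case: q' => i' j' /= ? ? ? xy.
  have [ii|ii] : (i' < i)%N \/ (i' = i :> nat) /\ (j' < j)%N by lia.
    by nia.
  by nia.
have N0 x : conn (T (x, h)) 0 = false.
  have := conn_vertical oT dM x (h + 1); rewrite addrK => ->.
  by rewrite blank //; apply/orP; left; lia.
have Tl : T (l, h) = OneArc 1.
  apply: left_end_of_cap; rewrite ?N0 //.
    by rewrite /T /l /h -surjective_pairing tile_at_centre.
  have := conn_horizontal oT dM (l - 1) h; rewrite subrK => <-.
  by rewrite blank //; apply/orP; right; lia.
have ex : exists k : nat, ~~ is_hline (T (l + k.+1.*2%:Z, h)).
  exists n; rewrite /T tile_at_blank // => -[i j].
  by apply/eqP => -[]; rewrite /l /=; have := ltn_ord j; lia.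
have [k nk mk] := ex_minnP ex.
have hk j : (j < k)%N -> T (l + j.+1.*2%:Z, h) = OneLine true.
  by move=> jk; apply/is_hlineP; apply: contraTT jk => /mk; rewrite -leqNgt.
exists l, (l + k.+1.*2%:Z), h; split=> //.
- by lia.
- apply: right_end_of_cap; rewrite ?N0 //; last exact/is_hlineP.
  have := conn_horizontal oT dM (l + k.+1.*2%:Z - 1) h; rewrite subrK => <-.
  case: k {nk mk} hk => [_|k hk].
    by rewrite (_ : _ - 1 - 1 = l) ?Tl //; lia.
  by rewrite (_ : _ - 1 - 1 = l + k.+1.*2%:Z) ?hk //; lia.
- move=> x lxr xo; have lo : ~~ (2 %| l)%Z by rewrite /l /=; lia.
  have := hk (`|(x - l - 2)%R|%N %/ 2)%N.
  rewrite (_ : l + _ = x); last by lia.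
  by apply; lia.
- by move=> x y hy; apply: blank; rewrite hy.
Qed.

(** * Lowering a cap *)

(** The points of height [h - 1] with an even abscissa between [l] and [r] are
the vertices of the grid on the lower edge of the cap.  The diamonds around
them carry the pushed cap; the coordinates are still those of the traditional
mosaic. *)
Definition lowered (T : int * int -> tile) (l r h : int) (z : int * int) :
    tile :=
  if [&& z.2 == h - 1, l < z.1, z.1 < r & (2 %| z.1)%Z] then OneLine true
  else if [&& z.2 == h, l <= z.1 & z.1 <= r] then Blank else T z.

Section lowering.
Variables (T : int * int -> tile) (l r h : int).
Hypotheses (oT : odd_supported T) (dT : closed_diagram Traditional T).
Hypothesis capT : cap T l r h.

Lemma left_odd : ~~ (2 %| l)%Z.
Proof. by apply: contraPN (cap_left capT) => le; rewrite oT ?le. Qed.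

Lemma right_odd : ~~ (2 %| r)%Z.
Proof. by apply: contraPN (cap_right capT) => re; rewrite oT ?re. Qed.

Lemma height_odd : ~~ (2 %| h)%Z.
Proof. by apply: contraPN (cap_left capT) => he; rewrite oT ?he ?orbT. Qed.

Lemma lowered_new x y : y = h - 1 -> l < x < r -> (2 %| x)%Z ->
  lowered T l r h (x, y) = OneLine true.
Proof. by move=> -> /andP[lx xr] x2; rewrite /lowered /= eqxx lx xr x2. Qed.

Lemma lowered_cap x y : y = h -> l <= x <= r -> lowered T l r h (x, y) = Blank.
Proof.
move=> -> /andP[lx xr]; rewrite /lowered /= eqxx lx xr /=.
by rewrite ifF //; apply/negP; lia.
Qed.

Lemma lowered_other x y :
  ~ (y = h - 1 /\ l < x < r /\ (2 %| x)%Z) -> ~ (y = h /\ l <= x <= r) ->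
  lowered T l r h (x, y) = T (x, y).
Proof.
move=> n1 n2; rewrite /lowered /= ifF; last by apply/negP; lia.
by rewrite ifF //; apply/negP; lia.
Qed.

Lemma lowered_mixed x y : (2 %| x)%Z != (2 %| y)%Z ->
  lowered T l r h (x, y) = Blank.
Proof.
have ho := height_odd; move=> xy.
have [H|H] := boolP ((y == h) && (l <= x <= r)).
  by apply: lowered_cap; lia.
rewrite lowered_other; [apply: oT | |]; lia.
Qed.

Lemma cap_conn x : l <= x <= r -> ~~ (2 %| x)%Z ->
  [/\ conn (T (x, h)) 0 = false, conn (T (x, h)) 1 = (x < r),
      conn (T (x, h)) 2 = (x == l) || (x == r) & conn (T (x, h)) 3 = (l < x)].
Proof.
move=> lxr xo; have lr := cap_lt capT.
have [->|xl] := eqVneq x l.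
  by rewrite (cap_left capT) lr ltxx.
have [->|xr] := eqVneq x r.
  by rewrite (cap_right capT) lr ltxx.
have lxr' : l < x < r by lia.
by rewrite (cap_middle capT lxr' xo); case/andP: lxr' => -> ->.
Qed.

(** A midpoint of a horizontal edge has tiles above and below it and vertex
diamonds to its left and right; for a vertical edge it is the other way round.
At each end of the cap, on its lower edge, a diamond takes the place of the arc
that came from above, and each point strictly between them, which no tile touched before,
is now shared by two diamonds. *)
Lemma lowered_closed : closed_diagram Traditional (lowered T l r h).
Proof.
move=> [x y]; have lo := left_odd; have ro := right_odd; have ho := height_odd.
have lr := cap_lt capT.
have [xy|xy] := eqVneq (2 %| x)%Z (2 %| y)%Z.
  rewrite /degree !linked_traditional !lowered_mixed ?conn_blank //; lia.
have [xe|xo] := boolP (2 %| x)%Z.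
- have yo : ~~ (2 %| y)%Z by lia.
  have vert k y' : (2 %| y')%Z -> k \in [:: 0; 2] ->
      conn (lowered T l r h (x, y')) k = false.
    move=> y'e k02; have [H|H] := boolP ((y' == h - 1) && (l < x < r)).
      rewrite lowered_new; try lia.
      by move: k02; rewrite !inE; case/orP=> /eqP ->.
    by rewrite lowered_other ?oT ?xe //; lia.
  rewrite /degree !linked_traditional (vert 0) ?(vert 2) //; try lia.
  have C := conn_horizontal oT dT x y.
  have [yh|yh] := eqVneq y h; last first.
    by rewrite !lowered_other; try lia; rewrite C !inE; case: conn.
  have [xl|xl] := ltrP x l.
    have [xl1|xl1] := eqVneq (x + 1) l.
      rewrite lowered_other ?C; try lia.
      rewrite [lowered _ _ _ _ (x + 1, _)]lowered_cap; try lia.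
      by rewrite xl1 yh (cap_left capT).
    by rewrite !lowered_other; try lia; rewrite C !inE; case: conn.
  have [xr|xr] := ltrP r x.
    have [xr1|xr1] := eqVneq (x - 1) r.
      rewrite [lowered _ _ _ _ (x + 1, _)]lowered_other -?C; try lia.
      rewrite lowered_cap; try lia.
      by rewrite xr1 yh (cap_right capT).
    by rewrite !lowered_other; try lia; rewrite C !inE; case: conn.
  by rewrite !lowered_cap //; lia.
- have ye : (2 %| y)%Z by lia.
  have horiz k x' : (2 %| x')%Z -> k \in [:: 1; 3] ->
      conn (lowered T l r h (x', y)) k = (y == h - 1) && (l < x' < r).
    move=> x'e k02; have [H|H] := boolP ((y == h - 1) && (l < x' < r)).
      rewrite lowered_new; try lia.
      by move: k02; rewrite !inE; case/orP=> /eqP ->.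
    by rewrite lowered_other ?oT ?ye ?orbT //; lia.
  rewrite /degree !linked_traditional (horiz 1) ?(horiz 3) //; try lia.
  have C := conn_vertical oT dT x y.
  have [lxr|nlxr] := boolP (l <= x <= r); last first.
    rewrite !lowered_other; try lia.
    have -> : (y == h - 1) && (l < x - 1 < r) = false by lia.
    have -> : (y == h - 1) && (l < x + 1 < r) = false by lia.
    by rewrite C !inE; case: conn.
  have [C0 _ C2 _] := cap_conn lxr xo.
  have [yh|yh] := eqVneq y (h - 1).
    rewrite lowered_other ?C; try lia.
    rewrite [lowered _ _ _ _ (x, y + 1)]lowered_cap; try lia.
    rewrite yh subrK C2 conn_blank ?eqxx /= !inE; lia.
  have [yh1|yh1] := eqVneq (y - 1) h.
    rewrite lowered_cap //.
    rewrite [lowered _ _ _ _ (x, y + 1)]lowered_other -?C; try lia.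
    by rewrite yh1 C0.
  by rewrite !lowered_other; try lia; rewrite C !inE; case: conn.
Qed.

End lowering.

(** * Diamonds as corner connection tiles *)

(** The eighth of a turn takes centres of diamonds of either kind to pairs of
even integers, and the odd translation makes them centres of tiles of a square
array of size [n + n]. *)
Definition rotate (n : nat) (z : int * int) : int * int :=
  (z.1 + z.2 + n.*2.+1%:Z, z.2 - z.1 + 1).

(** The argument of [T] is the inverse image under [rotate n] of the centre of
the tile [(i, j)]. *)
Definition rotated_mosaic n (T : int * int -> tile) : 'M[tile]_(n + n) :=
  \matrix_(i, j) T ((i : nat)%:Z + (j : nat)%:Z + 1 - n%:Z,
                    (j : nat)%:Z - (i : nat)%:Z - 1 - n%:Z).

Lemma rotate_offset n p k :
  rotate n p - offset Corner k = rotate n (p - offset Traditional k).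
Proof.
case: p => x y; rewrite /rotate.
by elim/ordinal4P: k; congr (_, _) => /=; lia.
Qed.

Lemma tile_at_rotated n T z :
  (~~ is_blank (T z) ->
    exists q : 'I_(n + n) * 'I_(n + n), rotate n z = centre q) ->
  tile_at (rotated_mosaic n T) (rotate n z) = T z.
Proof.
move=> nbz; have [/existsP[q /eqP cq]|nex] :=
    boolP [exists q : 'I_(n + n) * 'I_(n + n), centre q == rotate n z].
  rewrite -cq tile_at_centre mxE; congr T; case: z {nbz} cq => x y [].
  by move=> /= e1 e2; congr (_, _); lia.
rewrite tile_at_blank; last first.
  by move=> q; apply: contra nex => cq; apply/existsP; exists q.
have [|/nbz[q zq]] := boolP (is_blank (T z)); first by case: (T z).
by case/existsP: nex; exists q; rewrite zq.
Qed.

Lemma centreP n x y :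
  (exists q : 'I_n * 'I_n, (x, y) = centre q) <->
  [/\ ~~ (2 %| x)%Z, ~~ (2 %| y)%Z, 0 <= x < n.*2%:Z & - n.*2%:Z < y < 0].
Proof.
split=> [[[i j] [-> ->]]|[xo yo x0 y0]].
  by have := ltn_ord i; have := ltn_ord j; split; lia.
have iP : (`|y|%N %/ 2 < n)%N by lia.
have jP : (`|x|%N %/ 2 < n)%N by lia.
by exists (Ordinal iP, Ordinal jP); congr (_, _) => /=; lia.
Qed.

(** All nonblank tiles lie within the rotated array, the new diamonds because
they are between the two ends of the cap. *)
Lemma tile_at_lowered n (M : 'M[tile]_n) l r h z : cap (tile_at M) l r h ->
  let L := lowered (tile_at M) l r h in
  tile_at (rotated_mosaic n L) (rotate n z) = L z.
Proof.
move=> capM L; apply: tile_at_rotated; case: z => x y nb.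
have nl : ~~ is_blank (tile_at M (l, h)) by rewrite (cap_left capM).
have nr : ~~ is_blank (tile_at M (r, h)) by rewrite (cap_right capM).
have /centreP[lo ho l0 h0] := tile_at_nonblank nl.
have /centreP[ro _ r0 _] := tile_at_nonblank nr.
apply/centreP => /=.
have [H|H] := boolP [&& y == h - 1, l < x, x < r & (2 %| x)%Z].
  by split; lia.
have [H'|H'] := boolP [&& y == h, l <= x & x <= r].
  by move: nb; rewrite /L lowered_cap //; lia.
move: nb; rewrite /L lowered_other; try lia.
by move=> /tile_at_nonblank/centreP[xo yo x0 y0]; split; lia.
Qed.

Lemma rotate_surjective n (z : int * int) (q : 'I_(n + n) * 'I_(n + n)) :
  z = centre q -> exists z', z = rotate n z'.
Proof.
case: q => i j ->; exists ((i : nat)%:Z + (j : nat)%:Z + 1 - n%:Z,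
                    (j : nat)%:Z - (i : nat)%:Z - 1 - n%:Z).
by congr (_, _) => /=; lia.
Qed.

Lemma degree_rotate n (T T' : int * int -> tile) p :
  (forall z, T' (rotate n z) = T z) ->
  degree Corner T' (rotate n p) = degree Traditional T p.
Proof. by move=> TT'; rewrite /degree /linked !rotate_offset !TT'. Qed.

Lemma lowered_mosaic n (M : 'M[tile]_n) l r h :
  mosaic Traditional M -> cap (tile_at M) l r h ->
  mosaic Corner (rotated_mosaic n (lowered (tile_at M) l r h)).
Proof.
move=> /mosaic_degree dM capM; apply/mosaic_degree => p.
have [k lk|nl] := pickP (linked Corner (tile_at
    (rotated_mosaic n (lowered (tile_at M) l r h))) p); last first.
  by rewrite /degree !nl.
have [q pq] := tile_at_nonblank (conn_nonblank lk).
have [z zq] := rotate_surjective pq.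
have -> : p = rotate n (z + offset Traditional k).
  move: (rotate_offset n (z + offset Traditional k) k); rewrite addrK -zq.
  by move/addIr.
rewrite (@degree_rotate n (lowered (tile_at M) l r h)) => [|z'].
  exact/lowered_closed/capM/dM/tile_at_odd_supported.
exact: tile_at_lowered.
Qed.

(** Sending each new diamond to the cap tile above it on the left, and every
other tile to itself, is injective and misses the right end of the cap. *)
Lemma nonblank_lowered n (M : 'M[tile]_n) l r h : cap (tile_at M) l r h ->
  (nonblank_tiles (rotated_mosaic n (lowered (tile_at M) l r h)) <
   nonblank_tiles M)%N.
Proof.
move=> capM; set M' := rotated_mosaic _ _.
have oM := tile_at_odd_supported M; have lr := cap_lt capM.
have lo := left_odd oM capM; have ro := right_odd oM capM.
have ho := height_odd oM capM.
pose unrotate (q : 'I_(n + n) * 'I_(n + n)) : int * int :=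
  ((q.1 : nat)%:Z + (q.2 : nat)%:Z + 1 - n%:Z,
   (q.2 : nat)%:Z - (q.1 : nat)%:Z - 1 - n%:Z).
have M'E q : M' q.1 q.2 = lowered (tile_at M) l r h (unrotate q).
  by rewrite mxE.
pose w q := let z := unrotate q in
  if (2 %| z.1)%Z then (z.1 - 1, z.2 + 1) else z.
pose A := [pred q : 'I_n * 'I_n | ~~ is_blank (M q.1 q.2)].
pose A' := [pred q : 'I_(n + n) * 'I_(n + n) | ~~ is_blank (M' q.1 q.2)].
have wP q : q \in A' ->
    [/\ ~~ is_blank (tile_at M (w q)), w q <> (r, h)
      & (2 %| (unrotate q).1)%Z = ((w q).2 == h) && (l <= (w q).1 <= r)].
  rewrite inE M'E /w; case: (unrotate q) => x y /= nb.
  have [H|H] := boolP [&& y == h - 1, l < x, x < r & (2 %| x)%Z].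
    have -> : (2 %| x)%Z by lia.
    have -> : y + 1 = h by lia.
    split=> /=; [|by move=> []; lia|by lia].
    have [->|xl] := eqVneq (x - 1) l; first by rewrite (cap_left capM).
    by rewrite (cap_middle capM) //; lia.
  have [H'|H'] := boolP [&& y == h, l <= x & x <= r].
    by move: nb; rewrite lowered_cap //; lia.
  move: nb; rewrite lowered_other; try lia.
  move=> nb; have /norP[xo yo] : ~~ ((2 %| x)%Z || (2 %| y)%Z).
    by apply: contraNN nb => /oM ->.
  by rewrite (negbTE xo); split=> //=; [move=> []|]; lia.
have w_inj : {in A' &, injective w}.
  move=> q q' /wP[_ _ e] /wP[_ _ e'] ww; have : unrotate q = unrotate q'.
    have ee : (2 %| (unrotate q).1)%Z = (2 %| (unrotate q').1)%Z.
      by rewrite e e' ww.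
    move: ww; rewrite /w -ee; case: ifP => // _.
    case: (unrotate q) => x y; case: (unrotate q') => x' y' /= [].
    by move=> /addIr -> /addIr ->.
  case: q q' {e e' ww} => i j [i' j'] [] /= ? ?.
  by congr (_, _); apply/val_inj => /=; lia.
rewrite /nonblank_tiles -/A -/A' !cardE.
rewrite -(size_map w) -(size_map (@centre n) (enum A)).
apply: (@uniq_leq_size _ ((r, h) :: map w (enum A'))).
  rewrite /= map_inj_in_uniq ?enum_uniq ?andbT; last first.
    by move=> q q'; rewrite !mem_enum; exact: w_inj.
  apply/mapP => -[q]; rewrite mem_enum => /wP[_ + _].
  by move/eqP; rewrite eq_sym => /eqP.
have nbP z : ~~ is_blank (tile_at M z) -> z \in map (@centre n) (enum A).
  move=> nb; have [q zq] := tile_at_nonblank nb.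
  by rewrite zq map_f // mem_enum inE -tile_at_centre -zq.
move=> z; rewrite inE => /predU1P[->|/mapP[q]].
  by apply: nbP; rewrite (cap_right capM).
by rewrite mem_enum => /wP[nb _ _] ->; exact: nbP.
Qed.

(** * The link of a tiling and its rotation *)

Section drawing.
Variable R : realType.
Implicit Types (p a b : space3 R) (z : int * int) (c : curve).

Definition bend_at (s : style) z c : space3 R :=
  let o := plane_point R z in
  match c with
  | Arc k => 2^-1 *: o + 4^-1 *: (plane_point R (z + offset s k) +
                                  plane_point R (z + offset s (k + 1)))
  | Line _ => o
  | Over _ => o + (0, 0, 1)
  end.

Definition draw_at (s : style) z c : set (space3 R) :=
  segment (plane_point R (z + offset s (source c))) (bend_at s z c) `|`
  segment (bend_at s z c) (plane_point R (z + offset s (target c))).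

Definition tiling_link (s : style) (T : int * int -> tile) : set (space3 R) :=
  [set p | exists z c, List.In c (curves (T z)) /\ draw_at s z c p].

Lemma bigsetU_listP (X : Type) (F : X -> set (space3 R)) (l : seq X) p :
  (\big[setU/set0]_(x <- l) F x) p <-> exists x, List.In x l /\ F x p.
Proof.
elim: l => [|x l IH]; first by rewrite big_nil; split=> // -[? []].
rewrite big_cons; split=> [[Fx|/IH[y [ly Fy]]]|[y /= [[->|ly] Fy]]].
- by exists x; split=> //; left.
- by exists y; split=> //; right.
- by left.
- by right; apply/IH; exists y.
Qed.

Lemma mosaic_linkE s n (M : 'M[tile]_n) :
  mosaic_link s M = tiling_link s (tile_at M).
Proof.
have drawE (q : 'I_n * 'I_n) c : draw s q c = draw_at s (centre q) c.
  by case: c.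
apply/seteqP; split=> [p [q _ /bigsetU_listP[c [qc pc]]]|p [z [c [zc pc]]]].
  by exists (centre q), c; rewrite tile_at_centre -drawE.
have [q zq] : exists q : 'I_n * 'I_n, z = centre q.
  by apply: (@tile_at_nonblank _ M); case: (tile_at M z) zc.
exists q => //; apply/bigsetU_listP; exists c.
by rewrite drawE -zq; split=> //; rewrite -tile_at_centre -zq.
Qed.

Lemma segmentP a b p : segment a b p <-> exists t,
  [/\ 0 <= t <= 1, p.1.1 = (1 - t) * a.1.1 + t * b.1.1,
      p.1.2 = (1 - t) * a.1.2 + t * b.1.2 & p.2 = (1 - t) * a.2 + t * b.2].
Proof.
split=> [[t /= t01 <-]|[t [t01 e1 e2 e3]]].
  by exists t; split=> //; move: t01; rewrite in_itv.
exists t; first by rewrite /= in_itv.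
by case: p e1 e2 e3 => [[x y] w] /= -> -> ->.
Qed.

Definition eighth_turn (n : nat) : space3 R -> space3 R :=
  turn (n.*2.+1%:R / 2) 2^-1 1.

Lemma eighth_turn_segment n a b :
  eighth_turn n @` segment a b = segment (eighth_turn n a) (eighth_turn n b).
Proof.
have lin t p q : eighth_turn n ((1 - t) *: p + t *: q) =
    (1 - t) *: eighth_turn n p + t *: eighth_turn n q.
  case: p q => [[x y] w] [[x' y'] w']; rewrite /eighth_turn /turn.
  by congr (_, _, _); rewrite /= /GRing.scale /=; ring.
apply/seteqP; split=> [_ [_ [t t01 <-] <-]|_ [t t01 <-]].
  by rewrite lin; exists t.
by rewrite -lin; exists ((1 - t) *: a + t *: b) => //; exists t.
Qed.

Lemma eighth_turn_plane_point n z :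
  eighth_turn n (plane_point R z) = plane_point R (rotate n z).
Proof.
case: z => x y; rewrite /eighth_turn /turn /plane_point /rotate /=.
rewrite !intrD mulrNz -!pmulrn.
by congr (_, _, _); field.
Qed.

Lemma rotateD n z k :
  rotate n (z + offset Traditional k) = rotate n z + offset Corner k.
Proof.
by rewrite -[z in RHS](addrK (offset Traditional k)) -rotate_offset subrK.
Qed.

Lemma eighth_turn_draw n z c :
  eighth_turn n @` draw_at Traditional z c = draw_at Corner (rotate n z) c.
Proof.
have bendE : eighth_turn n (bend_at Traditional z c) =
    bend_at Corner (rotate n z) c.
  case: c => k; rewrite /bend_at -?rotateD -?eighth_turn_plane_point //.
  - move: (plane_point _ _) (plane_point _ _) (plane_point _ _).
    move=> [[x y] w] [[x' y'] w'] [[x1 y1] w1]; rewrite /eighth_turn /turn.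
    by congr (_, _, _); rewrite /= /GRing.scale /=; field.
  - move: (plane_point _ _) => [[x y] w]; rewrite /eighth_turn /turn.
    by congr (_, _, _); rewrite /=; ring.
rewrite /draw_at image_setU !eighth_turn_segment bendE.
by rewrite !eighth_turn_plane_point !rotateD.
Qed.

(** The rotation carries connection points to connection points with the same
number, and it is affine, so it respects the way points of all curves. *)
Lemma eighth_turn_link n (T T' : int * int -> tile) :
  (forall z, T' (rotate n z) = T z) ->
  (forall z, ~~ is_blank (T' z) -> exists z', z = rotate n z') ->
  eighth_turn n @` tiling_link Traditional T = tiling_link Corner T'.
Proof.
move=> T'T sT'; apply/seteqP.
split=> [_ [p [z [c [zc pc]]] <-]|p [z [c [zc pc]]]].
  exists (rotate n z), c; rewrite T'T -eighth_turn_draw; split=> //.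
have [z' zz'] : exists z', z = rotate n z' by apply: sT'; case: (T' z) zc.
move: zc pc; rewrite zz' T'T -eighth_turn_draw => zc [p' pc' <-].
by exists p' => //; exists z', c.
Qed.

End drawing.
(** * Pushing the cap down *)

Section hump.
Variable R : realType.
Implicit Types (p : space3 R) (z : int * int) (c : curve).

(** Coordinates relative to the centre of the tile, with the side of a tile as
unit: [port k] is the [k]-th connection point, [bend c] the way point. *)
Definition port (k : 'I_4) : R * R :=
  nth (0, 0) [:: (0, 1/2); (1/2, 0); (0, -1/2); (-1/2, 0)] k.

Definition bend c : space3 R :=
  match c with
  | Arc k => (((port k).1 + (port (k + 1)).1) / 4,
              ((port k).2 + (port (k + 1)).2) / 4, 0)
  | Line _ => (0, 0, 0)
  | Over _ => (0, 0, 1)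
  end.

Lemma plane_point_offset z k : plane_point R (z + offset Traditional k) =
  (z.1%:~R / 2 + (port k).1, z.2%:~R / 2 + (port k).2, 0).
Proof.
case: z => x y; rewrite /plane_point /=; rewrite !intrD !mulrDl.
by elim/ordinal4P: k; congr (_ + _, _ + _, _); rewrite /offset /port /=; ring.
Qed.

Lemma bend_atE z c : bend_at R Traditional z c =
  (z.1%:~R / 2 + (bend c).1.1, z.2%:~R / 2 + (bend c).1.2, (bend c).2).
Proof.
case: c => k; rewrite /bend_at /bend ?plane_point_offset /plane_point.
- by congr (_, _, _); rewrite /= /GRing.scale /=; field.
- by rewrite /= !addr0.
- by congr (_, _, _); rewrite /= ?addr0 ?add0r.
Qed.

Lemma drawE z c p : draw_at Traditional z c p <-> exists t k,
  [/\ 0 <= t <= 1, k = source c \/ k = target c,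
      p.1.1 - z.1%:~R / 2 = (1 - t) * (port k).1 + t * (bend c).1.1,
      p.1.2 - z.2%:~R / 2 = (1 - t) * (port k).2 + t * (bend c).1.2 &
      p.2 = t * (bend c).2].
Proof.
rewrite /draw_at bend_atE !plane_point_offset; split.
  case=> /segmentP[t [t01 /= e1 e2 e3]].
    exists t, (source c); split; [lra|by left|lra|lra|lra].
  exists (1 - t), (target c); split; [lra|by right|lra|lra|lra].
case=> t [k [t01 [->|->] e1 e2 e3]]; [left|right]; apply/segmentP.
  exists t; split=> /=; lra.
exists (1 - t); split=> /=; lra.
Qed.

Lemma ordinal4_succ :
  (0 + 1 = 1 :> 'I_4) * (1 + 1 = 2 :> 'I_4) * (2 + 1 = 3 :> 'I_4) *
  (3 + 1 = 0 :> 'I_4) * (0 + 2 = 2 :> 'I_4) * (1 + 2 = 3 :> 'I_4) *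
  (2 + 2 = 0 :> 'I_4) * (3 + 2 = 1 :> 'I_4).
Proof. by do 7 (split; last exact/val_inj); exact/val_inj. Qed.

Lemma portE : (port 0 = (0, 1/2)) * (port 1 = (1/2, 0)) *
  (port 2 = (0, -1/2)) * (port 3 = (-1/2, 0)).
Proof. by []. Qed.

(** The height, above the lower edge of its tile, of an arc from that edge to
the right edge, at horizontal distance [u] from its start: the line through the
start has slope 3, up to the way point at [u = 1/8], and then 1/3. *)
Definition profile (u : R) : R := Num.min (3 * u) (1/3 + u / 3).

(** A curve that ends on the upper edge of its tile stays below the reflected
profile of an arc; any other curve stays in the closed lower half of the
tile.  These bounds keep the tiles under the cap out of the support
of the shear. *)
Lemma draw_profile z c p : draw_at Traditional z c p ->
  let u := p.1.1 - z.1%:~R / 2 in let v := p.1.2 - z.2%:~R / 2 in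
  [/\ -1/2 <= u <= 1/2, -1/2 <= v <= 1/2,
      v + profile u <= 1/2, v + profile (- u) <= 1/2 &
      source c != 0 -> target c != 0 -> v <= 0].
Proof.
move=> /drawE[t [k [t01 ek /= -> -> _]]]; rewrite /profile.
have min_or (a b c' d : R) : a + b <= d \/ a + c' <= d -> a + Num.min b c' <= d.
  by move=> H; rewrite minElt; case: ltP => ?; lra.
case: c ek => j; elim/ordinal4P: j => [] [->|->];
  rewrite /bend ?ordinal4_succ ?portE /=; split => //;
  (try lra); (try by [ ]); (try by apply: min_or; lra).
Qed.

Variables (T : int * int -> tile) (l r h : int).
Hypotheses (oT : odd_supported T) (dT : closed_diagram Traditional T).
Hypothesis capT : cap T l r h.

(** The cap is the graph of [hump] above the lower edge of its row: it follows
the profile at both ends and the middle line of the row in between. *)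
Definition hump (x : R) : R := Num.max 0
  (Num.min (1/2) (Num.min (profile (x - l%:~R / 2)) (profile (r%:~R / 2 - x)))).

Lemma hump_ge0 x : 0 <= hump x.
Proof. by rewrite /hump le_max lexx. Qed.

Lemma hump_le (x b : R) : 0 <= b ->
  [\/ 1/2 <= b, profile (x - l%:~R / 2) <= b | profile (r%:~R / 2 - x) <= b] ->
  hump x <= b.
Proof.
rewrite /hump; move: (profile _) (profile _) => v w b0 H.
rewrite ge_max b0 /= !ge_min.
by case: H => ->; rewrite ?orbT.
Qed.

Lemma hump_le_half x : hump x <= 1/2.
Proof. by apply: hump_le; [lra|apply: Or31]. Qed.

Lemma profile_le0 (u : R) : u <= 0 -> profile u <= 0.
Proof. by move=> u0; rewrite /profile ge_min; apply/orP; left; lra. Qed.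

Lemma hump_out x : (x <= l%:~R / 2) || (r%:~R / 2 <= x) -> hump x = 0.
Proof.
move=> H; apply/eqP; rewrite eq_le hump_ge0 andbT; apply: hump_le => //.
by case/orP: H => H; [apply: Or32|apply: Or33]; apply: profile_le0; lra.
Qed.

Lemma profile_continuous : continuous profile.
Proof. by rewrite /profile; cts. Qed.

Lemma hump_continuous : continuous hump.
Proof.
have c1 : continuous (fun x : R => profile (x - l%:~R / 2)).
  by apply: (cts_comp profile_continuous); cts.
have c2 : continuous (fun x : R => profile (r%:~R / 2 - x)).
  by apply: (cts_comp profile_continuous); cts.
by rewrite /hump; cts.
Qed.

Let y0 : R := (h - 1)%:~R / 2.

Definition push : space3 R -> space3 R := shear hump y0 1.

Lemma push_fix p : hump p.1.1 = 0 \/ p.1.2 - y0 + hump p.1.1 <= 0 -> push p = p.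
Proof.
case: p => [[x y] w] /= H; rewrite /push /shear /=; congr (_, _, _).
suff -> : clamp 2 (hump x) (y - y0 + hump x) = 0 by rewrite mulr0 subr0.
case: H => [->|H]; last by rewrite clamp_le // hump_ge0.
rewrite /clamp; apply/max_idPl; rewrite ge_min lexx orbT //.
Qed.

Lemma push_graph (x w : R) : push (x, y0 + hump x, w) = (x, y0, w).
Proof.
rewrite /push /shear /=; congr (_, _, _); rewrite clamp_ge //.
- by ring.
- exact: hump_ge0.
- by rewrite le_eqVlt; apply/orP; left; apply/eqP; ring.
Qed.

Lemma curve_nonblank (A : tile) c : List.In c (curves A) -> ~~ is_blank A.
Proof. by case: A. Qed.

Lemma curve_conn (A : tile) c : List.In c (curves A) ->
  conn A (source c) /\ conn A (target c).
Proof.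
rewrite /conn /connection_points; elim: (curves A) => //= c' s IH.
by case=> [->|/IH[H1 H2]]; rewrite !inE ?eqxx ?H1 ?H2 ?orbT.
Qed.

Lemma odd_gap (a b : int) : ~~ (2 %| a)%Z -> ~~ (2 %| b)%Z -> a < b ->
  a + 2 <= b.
Proof. lia. Qed.

(** Left and right of the cap, the hump vanishes.  A tile under the interior of
the cap has no upper connection point, so its curves stay half a unit below the
lower edge of the row, and those of a tile under an end of the cap do not rise
above the reflection of the hump in that edge. *)
Lemma push_outside z c p : List.In c (curves (T z)) ->
  ~~ [&& z.2 == h, l <= z.1 & z.1 <= r] -> draw_at Traditional z c p ->
  push p = p.
Proof.
case: z => x y; move=> /[dup] zc /curve_nonblank nb /= nin /draw_profile /=.
move=> [u1 v1 pv1 pv2 v0].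
have /norP[xo yo] : ~~ ((2 %| x)%Z || (2 %| y)%Z).
  by apply: contraNN nb => /oT ->.
have lo := left_odd oT capT; have ro := right_odd oT capT.
have ho := height_odd oT capT.
have yh : y <= h.
  by rewrite leNgt; apply/negP => /(cap_above capT x) E; move: nb; rewrite E.
have toR (a b : int) : a <= b -> a%:~R <= b%:~R :> R by rewrite ler_int.
apply: push_fix.
have [xl|lx] := ltrP x l.
  left; apply: hump_out; apply/orP; left.
  by have /toR := odd_gap xo lo xl; rewrite intrD; lra.
have [rx|xr] := ltrP r x.
  left; apply: hump_out; apply/orP; right.
  by have /toR := odd_gap ro xo rx; rewrite intrD; lra.
right; rewrite /y0 intrD.
have yh2 : y + 2 <= h.
  apply: odd_gap; rewrite // lt_neqAle yh andbT; move: nin.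
  by rewrite lx xr !andbT.
have [yE|yh4] := eqVneq (y + 2) h; last first.
  have : y + 2 + 2 <= h.
    by apply: odd_gap; rewrite ?lt_neqAle ?yh4 ?yh2 //; move: yo; clear; lia.
  by move/toR; rewrite !intrD; have := hump_le_half p.1.1; lra.
have yE' := yE; have {}yE : h%:~R = y%:~R + 2 :> R by rewrite -yE intrD.
suff : hump p.1.1 <= 1/2 - (p.1.2 - y%:~R / 2) by rewrite yE; lra.
apply: hump_le; first lra.
have [xl|xl] := eqVneq x l; first by apply: Or32; rewrite -xl; lra.
have [xr'|xr'] := eqVneq x r.
  by apply: Or33; move: pv2; rewrite opprB -xr'; lra.
apply: Or31; suff : p.1.2 - y%:~R / 2 <= 0 by lra.
have C : conn (T (x, y)) 0 = false.
  have := conn_vertical oT dT x (y + 1); rewrite addrK => ->.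
  rewrite -addrA yE' (cap_middle capT) // !lt_neqAle lx xr eq_sym xl xr' //.
have [cs ct] := curve_conn zc.
by apply: v0; [move: cs|move: ct]; apply: contraTneq => ->; rewrite C.
Qed.

Lemma profile_steep (u : R) : u <= 1/8 -> profile u = 3 * u.
Proof. by move=> u8; rewrite /profile min_l //; lra. Qed.

Lemma profile_gentle (u : R) : 1/8 <= u -> profile u = 1/3 + u / 3.
Proof. by move=> u8; rewrite /profile min_r //; lra. Qed.

Lemma hump_left (X : R) : l%:~R + 2 <= r%:~R :> R ->
  l%:~R / 2 <= X <= l%:~R / 2 + 1/2 -> hump X = profile (X - l%:~R / 2).
Proof.
move=> lr HX; rewrite /hump [profile (r%:~R / 2 - X)]profile_gentle; last lra.
by case: (lerP (X - l%:~R / 2) (1/8)) => H;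
  [rewrite profile_steep // | rewrite profile_gentle ?ltW //];
  rewrite [Num.min _ (1/3 + _)]min_l ?min_r ?max_r //; lra.
Qed.

Lemma hump_right (X : R) : l%:~R + 2 <= r%:~R :> R ->
  r%:~R / 2 - 1/2 <= X <= r%:~R / 2 -> hump X = profile (r%:~R / 2 - X).
Proof.
move=> lr HX; rewrite /hump [profile (X - l%:~R / 2)]profile_gentle; last lra.
by case: (lerP (r%:~R / 2 - X) (1/8)) => H;
  [rewrite profile_steep // | rewrite profile_gentle ?ltW //];
  rewrite [Num.min (1/3 + _) _]min_r ?min_r ?max_r //; lra.
Qed.

Lemma hump_top (X : R) : l%:~R / 2 + 1/2 <= X <= r%:~R / 2 - 1/2 ->
  hump X = 1/2.
Proof.
move=> HX; rewrite /hump !profile_gentle; try lra.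
by rewrite min_l ?max_r ?le_min //; lra.
Qed.

Lemma cap_cases x : l <= x <= r -> ~~ (2 %| x)%Z ->
  [\/ x = l, x = r | [/\ T (x, h) = OneLine true,
     l%:~R + 2 <= x%:~R :> R & x%:~R + 2 <= r%:~R :> R]].
Proof.
move=> /andP[lx xr] xo.
have lo := left_odd oT capT; have ro := right_odd oT capT.
have [xl|xl] := eqVneq x l; first exact: Or31.
have [xr'|xr'] := eqVneq x r; first exact: Or32.
have lx' : l < x by rewrite lt_neqAle lx eq_sym xl.
have xr'' : x < r by rewrite lt_neqAle xr xr'.
apply: Or33; split; first by rewrite (cap_middle capT) // lx'.
  by have := odd_gap lo xo lx'; rewrite -(ler_int R) intrD.
by have := odd_gap xo ro xr''; rewrite -(ler_int R) intrD.
Qed.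

Lemma cap_width : l%:~R + 2 <= r%:~R :> R.
Proof.
have := odd_gap (left_odd oT capT) (right_odd oT capT) (cap_lt capT).
by rewrite -(ler_int R) intrD.
Qed.

Lemma draw_cap x c p : l <= x <= r -> ~~ (2 %| x)%Z ->
  List.In c (curves (T (x, h))) -> draw_at Traditional (x, h) c p ->
  p = (p.1.1, y0 + hump p.1.1, 0) /\
  [/\ l%:~R / 2 <= p.1.1 <= r%:~R / 2 & x%:~R - 1 <= p.1.1 * 2 <= x%:~R + 1].
Proof.
move=> lxr xo; have lr := cap_width; case: p => [[X Y] Z] /=.
case: (cap_cases lxr xo) => [->|->|[-> lx xr]] {lxr xo}; rewrite /y0 intrD.
- rewrite (cap_left capT) => -[<-|//] /drawE[t [k [t01 ek /= e1 e2 e3]]].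
  move: ek e1 e2 e3; case=> ->; rewrite /= ?ordinal4_succ ?portE /= => e1 e2 ->.
    rewrite hump_left ?profile_gentle; try lra.
    by split; [congr (_, _, _)|split]; lra.
  rewrite hump_left ?profile_steep; try lra.
  by split; [congr (_, _, _)|split]; lra.
- rewrite (cap_right capT) => -[<-|//] /drawE[t [k [t01 ek /= e1 e2 e3]]].
  move: ek e1 e2 e3; case=> ->; rewrite /= ?ordinal4_succ ?portE /= => e1 e2 ->.
    rewrite hump_right ?profile_steep; try lra.
    by split; [congr (_, _, _)|split]; lra.
  rewrite hump_right ?profile_gentle; try lra.
  by split; [congr (_, _, _)|split]; lra.
- move=> -[<-|//] /drawE[t [k [t01 ek /= e1 e2 e3]]].
  move: ek e1 e2 e3; case=> ->; rewrite /= ?ordinal4_succ ?portE /= => e1 e2 ->;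
    rewrite hump_top; try lra; by split; [congr (_, _, _)|split]; lra.
Qed.

Lemma cap_draw x (X : R) : l <= x <= r -> ~~ (2 %| x)%Z ->
  l%:~R / 2 <= X <= r%:~R / 2 -> x%:~R - 1 <= X * 2 <= x%:~R + 1 ->
  exists2 c, List.In c (curves (T (x, h))) &
    draw_at Traditional (x, h) c (X, y0 + hump X, 0).
Proof.
move=> lxr xo; have lr := cap_width.
case: (cap_cases lxr xo) => [->|->|[-> lx xr]]
  {lxr xo} HX Hx; rewrite /y0 intrD.
- rewrite (cap_left capT); exists (Arc 1); first by left.
  (* The way point is at horizontal distance 1/8 from the lower end of the arc
     and 3/8 from the upper end. *)
  apply/drawE; rewrite hump_left; try lra.
  have [u8|u8] := lerP (X - l%:~R / 2) (1/8).
    exists (8 * (X - l%:~R / 2)), (target (Arc 1)).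
    rewrite profile_steep //= ?ordinal4_succ ?portE /=.
    by split; [lra|right|lra|lra|lra].
  exists (8 / 3 * (1/2 - (X - l%:~R / 2))), (source (Arc 1)).
  rewrite profile_gentle ?(ltW u8) //= ?ordinal4_succ ?portE /=.
  by split; [lra|left|lra|lra|lra].
- rewrite (cap_right capT); exists (Arc 2); first by left.
  apply/drawE; rewrite hump_right; try lra.
  have [u8|u8] := lerP (r%:~R / 2 - X) (1/8).
    exists (8 * (r%:~R / 2 - X)), (source (Arc 2)).
    rewrite profile_steep //= ?ordinal4_succ ?portE /=.
    by split; [lra|left|lra|lra|lra].
  exists (8 / 3 * (1/2 - (r%:~R / 2 - X))), (target (Arc 2)).
  rewrite profile_gentle ?(ltW u8) //= ?ordinal4_succ ?portE /=.
  by split; [lra|right|lra|lra|lra].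
- exists (Line 1); first by left.
  apply/drawE; rewrite hump_top; try lra.
  have [u0|u0] := lerP X (x%:~R / 2).
    exists (1 - (x%:~R - X * 2)), (target (Line 1)).
  rewrite /= ?ordinal4_succ ?portE /=.
    by split; [lra|right|lra|lra|lra].
  exists (1 - (X * 2 - x%:~R)), (source (Line 1)).
  rewrite /= ?ordinal4_succ ?portE /=.
  by split; [lra|left|lra|lra|lra].
Qed.

Lemma draw_bar x p :
  draw_at Traditional (x, h - 1) (Line 1) p <->
  p = (p.1.1, y0, 0) /\ x%:~R - 1 <= p.1.1 * 2 <= x%:~R + 1.
Proof.
rewrite drawE /y0; split=> [[t [k [t01 ek]]]|].
  case: p => [[X Y] Z] /=; rewrite mulr0 => e1 e2 e3.
  by case: ek e1 e2 e3 => ->; rewrite /= ?ordinal4_succ ?portE /= => e1 e2 ->;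
    split; [congr (_, _, _); lra|lra|congr (_, _, _); lra|lra].
case: p => [[X Y] Z] /= [[-> ->] HX].
have [Xx|xX] := lerP (X * 2) x%:~R.
  exists (1 - (x%:~R - X * 2)), (target (Line 1)).
  rewrite /= ?ordinal4_succ ?portE /=.
  by split; [lra|right|lra|lra|lra].
exists (1 - (X * 2 - x%:~R)), (source (Line 1)).
  rewrite /= ?ordinal4_succ ?portE /=.
by split; [lra|left|lra|lra|lra].
Qed.

(** The pushed cap is the horizontal segment between its two lowest points, cut
by the new diamonds into pieces of length one that are centred at vertices
rather than at middles of edges.  Hence a point of the cap has to be matched
with a diamond to the left or to the right of the tile that contains it. *)
Lemma push_link :
  push @` tiling_link Traditional T = tiling_link Traditional (lowered T l r h).
Proof.
have lo := left_odd oT capT; have ro := right_odd oT capT.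
have ho := height_odd oT capT; have lr := cap_lt capT.
have toR (a b : int) : a <= b -> a%:~R <= b%:~R :> R by rewrite ler_int.
apply/seteqP; split=> [_ [p [[x y] [c [zc pc]]] <-]|p [[x y] [c [zc pc]]]].
- have nb := curve_nonblank zc.
  have /norP[xo yo] : ~~ ((2 %| x)%Z || (2 %| y)%Z).
    by apply: contraNN nb => /oT ->.
  have [H|H] := boolP [&& y == h, l <= x & x <= r]; last first.
    rewrite (push_outside zc H pc); exists (x, y), c.
    by rewrite lowered_other //; lia.
  have /and3P[/eqP yh lx xr] := H; rewrite {}yh {H yo nb} in zc pc *.
  have lxr : l <= x <= r by rewrite lx.
  have [pE [plr px]] := draw_cap lxr xo zc pc.
  rewrite pE push_graph.
  have [x' [lx'r x'e px']] : exists x' : int, [/\ l < x' < r, (2 %| x')%Z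
      & x'%:~R - 1 <= p.1.1 * 2 <= x'%:~R + 1].
    have [Xx|xX] := ltrP (p.1.1 * 2) x%:~R.
      exists (x - 1); have : l < x by rewrite -(ltr_int R); lra.
      by split; [lia|lia|rewrite intrD; lra].
    have [xr'|xr'] := eqVneq x r.
      exists (x - 1); split; [lia|lia|]; move: plr; rewrite -xr' intrD; lra.
    by exists (x + 1); split; [lia|lia|rewrite intrD; lra].
  exists (x', h - 1), (Line 1); rewrite lowered_new //; split; first by left.
  by apply/draw_bar.
- have [H|H] := boolP [&& y == h - 1, l < x, x < r & (2 %| x)%Z].
    move/and4P: (H) => [/eqP yh lx xr xe].
    have lxr : l < x < r by rewrite lx.
    move: zc pc; rewrite yh lowered_new // => -[<-|//] /draw_bar[pE px].
    exists (p.1.1, y0 + hump p.1.1, 0); last by rewrite push_graph -pE.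
    have lR : l%:~R + 1 <= x%:~R :> R.
      by rewrite -(intrD _ l 1); apply: toR; lia.
    have rR : x%:~R + 1 <= r%:~R :> R.
      by rewrite -(intrD _ x 1); apply: toR; lia.
    have [Xx|xX] := ltrP (p.1.1 * 2) x%:~R.
      have xm : l <= x - 1 <= r by lia.
      have xmo : ~~ (2 %| x - 1)%Z by lia.
      have [||c' c'T c'p] := cap_draw (X := p.1.1) xm xmo;
        rewrite ?intrD; try lra.
      by exists (x - 1, h), c'.
    have xp : l <= x + 1 <= r by lia.
    have xpo : ~~ (2 %| x + 1)%Z by lia.
    have [||c' c'T c'p] := cap_draw (X := p.1.1) xp xpo;
      rewrite ?intrD; try lra.
    by exists (x + 1, h), c'.
  have [H'|H'] := boolP [&& y == h, l <= x & x <= r].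
    by move: zc; rewrite lowered_cap //; lia.
  move: zc; rewrite lowered_other; try lia.
  move=> zc; exists p; last exact: push_outside zc H' pc.
  by exists (x, y), c.
Qed.

End hump.

(** * Comparing the tile numbers *)

Lemma ambient_isotopic_nonempty (R : realType) (K L : set (space3 R)) :
  ambient_isotopic K L -> L !=set0 -> K !=set0.
Proof. by move=> [H [_ _ _ <-]] [_ [x Kx _]]; exists x. Qed.

Lemma lowered_isotopic (R : realType) n (M : 'M[tile]_n) l r h :
  mosaic Traditional M -> cap (tile_at M) l r h ->
  ambient_isotopic (mosaic_link Traditional M : set (space3 R))
    (mosaic_link Corner (rotated_mosaic n (lowered (tile_at M) l r h))).
Proof.
move=> /mosaic_degree dM capM; have oM := tile_at_odd_supported M.
rewrite !mosaic_linkE.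
rewrite -(@eighth_turn_link R n (lowered (tile_at M) l r h)); first last.
- by move=> z /tile_at_nonblank[q]; exact: rotate_surjective.
- by move=> z; exact: tile_at_lowered.
rewrite -(push_link R oM dM capM).
apply: ambient_isotopic_trans (turn_isotopic _ _ _).
by apply: shear_isotopic; [exact: hump_ge0|exact: hump_continuous].
Qed.

Lemma tile_number_exists (R : realType) s (K : set (space3 R)) n
    (M : 'M[tile]_n) :
  constructs s M K ->
  exists2 t, tile_number s K t & (t <= nonblank_tiles M)%N.
Proof.
move=> cM.
pose P t := `[< exists n (M : 'M[tile]_n),
  constructs s M K /\ nonblank_tiles M = t >].
have PM n' (M' : 'M[tile]_n') : constructs s M' K -> P (nonblank_tiles M').
  by move=> cM'; apply/asboolP; exists n', M'.
have [t /asboolP Pt mint] := ex_minnP (ex_intro P _ (PM _ _ cM)).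
by exists t; [split=> // *|]; apply/mint/PM.
Qed.

Theorem theorem4p2 (R : realType) (K : set (space3 R))
    (hK : tame_link K) (hsplit : split_link K)
    (t : nat) (ht : tile_number Traditional K t) :
  exists tc : nat, tile_number Corner K tc /\ (tc < t)%N.
Proof.
have [[n [M [[mM iM] <-]]] _] := ht.
have [L [a [b [iL _ _ [x Lx _] _]]]] := hsplit.
(* A split link is not empty, so some tile is not blank. *)
have : (mosaic_link Traditional M : set (space3 R)) !=set0.
  apply: (ambient_isotopic_nonempty iM).
  by apply: (ambient_isotopic_nonempty iL); exists x.
rewrite mosaic_linkE => -[p [z [c [zc _]]]].
have nbz := curve_nonblank zc; have [q zq] := tile_at_nonblank nbz.
rewrite zq tile_at_centre in nbz.
have [l [r [h capM]]] := cap_exists mM nbz.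
have cM' : constructs Corner (rotated_mosaic n (lowered (tile_at M) l r h)) K.
  split; first exact: lowered_mosaic.
  apply: ambient_isotopic_trans iM; apply: ambient_isotopic_sym.
  exact: lowered_isotopic.
have [tc ntc tcM] := tile_number_exists cM'.
by exists tc; split=> //; apply: leq_ltn_trans tcM _; exact: nonblank_lowered.
Qed.
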